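(* For every integer $k\geq 1$, $$\lim_{n\to\infty}\frac{q_k(n)}{|V(\Gamma_n)|}=\frac{1}{2^k},$$ where $\Gamma_n$ is the Fibonacci cube of dimension $n$ and $q_k(n)$ is the maximum number of pairwise (vertex-)disjoint subgraphs of $\Gamma_n$ isomorphic to the $k$-cube $Q_k$.
   Context: For a positive integer $n$, the $n$-cube $Q_n$ is the graph whose vertex set is the set of all binary strings $x_1x_2\ldots x_n$ with $x_i\in\{0,1\}$, two vertices being adjacent if and only if the corresponding strings differ in exactly one position. The Fibonacci cube $\Gamma_n$ is the subgraph of $Q_n$ induced by the strings with no two consecutive 1's. One has $|V(\Gamma_n)|=F_{n+2}$, where $F_0=0$, $F_1=1$, $F_n=F_{n-1}+F_{n-2}$ for $n\geq 2$ are the Fibonacci numbers. Subgraphs are called disjoint if they have no vertex in common; they are not required a priori to be induced. $q_k(n)$ denotes the maximum number of pairwise disjoint subgraphs of $\Gamma_n$ isomorphic to $Q_k$. *)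

(* Defs.v *)
From HB Require Import structures.
From mathcomp Require Import all_boot all_order all_algebra.
From mathcomp Require Import boolp.

Set Implicit Arguments.
Unset Strict Implicit.
Unset Printing Implicit Defensive.

Record sgraph := SGraph {
  vert :> finType;
  adj : rel vert;
  adj_sym : symmetric adj;
  adj_irrefl : irreflexive adj
}.

Definition isomorphic (G H : sgraph) : Prop :=
  exists2 f : G -> H, bijective f & {mono f : x y / adj x y}.

Section Induced.
Variables (G : sgraph) (A : {set G}).

Definition induced_adj : rel {x : G | x \in A} :=
  fun x y => adj (val x) (val y).

Lemma induced_sym : symmetric induced_adj.
Proof. by move=> x y; apply: adj_sym. Qed.

Lemma induced_irrefl : irreflexive induced_adj.
Proof. by move=> x; apply: adj_irrefl. Qed.

Definition induced : sgraph := SGraph induced_sym induced_irrefl.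

End Induced.

Section Subgraph.
Variable G : sgraph.

(* Edges are unordered pairs [set x; y] of adjacent vertices. *)
Definition edges : {set {set G}} :=
  [set [set p.1; p.2] | p : G * G & adj p.1 p.2].

(* A not necessarily induced subgraph: any set of vertices together with any
   set of edges of G whose endpoints are among these vertices. *)
Definition is_subgraph (H : {set G} * {set {set G}}) : bool :=
  (H.2 \subset edges) && [forall e in H.2, e \subset H.1].

Record subgraph := Subgraph {
  subgraph_val : {set G} * {set {set G}};
  subgraph_valP : is_subgraph subgraph_val
}.

HB.instance Definition _ := [isSub for subgraph_val].
HB.instance Definition _ := [Finite of subgraph by <:].

Definition sub_verts (H : subgraph) : {set G} := (val H).1.
Definition sub_edges (H : subgraph) : {set {set G}} := (val H).2.

Definition sub_adj (H : subgraph) : rel {x : G | x \in sub_verts H} :=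
  fun x y => [set val x; val y] \in sub_edges H.

Lemma sub_adj_sym (H : subgraph) : symmetric (@sub_adj H).
Proof. by move=> x y; rewrite /sub_adj setUC. Qed.

Lemma sub_adj_irrefl (H : subgraph) : irreflexive (@sub_adj H).
Proof.
move=> x; apply/negP => xH.
have /andP[/subsetP sHG _] := valP H.
have /imsetP[[a b]] := sHG _ xH; rewrite inE /= => ab /setP eq_ab.
have /eqP ax : a == val x.
  by have := eq_ab a; rewrite !inE eqxx orbb.
have /eqP bx : b == val x.
  by have := eq_ab b; rewrite !inE eqxx orbb orbT.
by rewrite ax bx adj_irrefl in ab.
Qed.

Definition graph_of_subgraph (H : subgraph) : sgraph :=
  SGraph (@sub_adj_sym H) (@sub_adj_irrefl H).

End Subgraph.

Definition disjoint_copies (K G : sgraph) (F : {set subgraph G}) : Prop :=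
  (forall H, H \in F -> isomorphic (graph_of_subgraph H) K) /\
  (forall H1 H2, H1 \in F -> H2 \in F -> H1 != H2 ->
     [disjoint sub_verts H1 & sub_verts H2]).

Definition max_disjoint_copies (K G : sgraph) : nat :=
  \max_(F : {set subgraph G} | `[< disjoint_copies K F >]) #|F|.

Section Cube.
Variable n : nat.

Definition cube_adj : rel (n.-tuple bool) :=
  fun x y => #|[set i | tnth x i != tnth y i]| == 1.

Lemma cube_sym : symmetric cube_adj.
Proof.
move=> x y; rewrite /cube_adj; congr (_ == _).
by apply: eq_card => i; rewrite !inE eq_sym.
Qed.

Lemma cube_irrefl : irreflexive cube_adj.
Proof.
move=> x; rewrite /cube_adj (_ : [set _ | _] = set0) ?cards0 //.
by apply/setP => i; rewrite !inE eqxx.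
Qed.

Definition cube : sgraph := SGraph cube_sym cube_irrefl.

(* [sorted] checks consecutive entries only. *)
Definition no_consecutive_ones (x : n.-tuple bool) : bool :=
  sorted (fun a b => ~~ (a && b)) x.

Definition fib_cube : sgraph :=
  @induced cube [set x : n.-tuple bool | no_consecutive_ones x].

End Cube.

Definition q (k n : nat) : nat := max_disjoint_copies (cube k) (fib_cube n).

(* Main.v *)
Require Import Defs.
From mathcomp Require Import all_boot all_order all_algebra.
From mathcomp Require Import all_classical all_reals all_analysis.
From mathcomp Require Import zify ring lra.
Import Order.TTheory GRing.Theory Num.Theory.
Import numFieldNormedType.Exports.

(** Write V n for the number of vertices of the n-dimensional Fibonacci cube.
    Disjoint copies of the k-cube use 2^k vertices each, so q k n * 2^k <= V n
    ([max_disjoint_copies_le]); what has to be shown is that some packing leaves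
    only a vanishing proportion of the vertices uncovered.

    Split the Fibonacci strings of length n+3 by their prefix: they are 00w and
    10w with w of length n+1, and 010w with w of length n.  The strings 00w and
    10w together form the product of an edge with a Fibonacci cube, so a packing
    of the latter by k-cubes doubles to a packing of the former by (k+1)-cubes,
    while the strings 010w are packed by (k+1)-cubes recursively
    ([packs_step]).  If u k n vertices are left uncovered, this gives
      u (k+1) (n+3) <= 2 * u k (n+1) + u (k+1) n,   u 0 n = 0,
    hence u k n <= 3 * (n+1)^k ([packs_exists]): polynomial in n for fixed k.

    On the other hand V (n+2) >= 2 * V n, so V grows exponentially and
    (n+1)^(k+1) is at most a constant times V n ([expn_le_card_fib_cube]).
    Therefore the uncovered proportion is O(1/(n+1)), and the limit follows by
    squeezing. *)

Set Implicit Arguments.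
Unset Strict Implicit.
Unset Printing Implicit Defensive.

(** * Disjoint copies of a graph *)

Lemma isomorphic_sym (G H : sgraph) : isomorphic G H -> isomorphic H G.
Proof.
case=> f [g fK gK] fm; exists g; first by exists f.
by move=> x y; rewrite -fm !gK.
Qed.

Lemma isomorphic_card (G H : sgraph) : isomorphic G H -> #|G| = #|H|.
Proof. by case=> f /bij_eq_card. Qed.

Lemma card_cube (k : nat) : #|cube k| = 2 ^ k.
Proof. by rewrite /= card_tuple card_bool. Qed.

(** Counting incidences between vertices and copies: each copy has [#|K|]
    vertices and, by disjointness, each vertex lies in at most one copy. *)
Lemma max_disjoint_copies_le (K G : sgraph) :
  max_disjoint_copies K G * #|K| <= #|G|.
Proof.
rewrite /max_disjoint_copies.
elim/big_ind: _ => [//|a b ha hb|F /asboolP [copyF disjF]].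
  by rewrite maxnMl geq_max ha hb.
have -> : #|F| * #|K| = \sum_(H in F) \sum_(x in sub_verts H) 1.
  rewrite -sum_nat_const; apply: eq_bigr => H HF.
  by rewrite sum1_card -(isomorphic_card (copyF H HF)) /= card_sig.
rewrite (exchange_big_dep predT) //= -sum1_card leq_sum // => x _.
rewrite sum1_card; apply/card_le1_eqP => H1 H2 /andP[F1 x1] /andP[F2 x2].
have [//|ne] := eqVneq H1 H2; have := disjF _ _ F1 F2 ne.
by rewrite disjoint_subset => /fintype.subsetP /(_ x x1); rewrite !inE x2.
Qed.

Lemma mem_edges (G : sgraph) (a b : G) : ([set a; b] \in edges G) = adj a b.
Proof.
apply/imsetP/idP => [[[c d]]|ab]; last by exists (a, b); rewrite ?inE.
rewrite inE /= => cd /setP eq_e.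
have := eq_e c; have := eq_e d.
rewrite !inE !eqxx ?orbT /= => /orP[]/eqP d_ /orP[]/eqP c_; subst => //.
- by rewrite adj_irrefl in cd.
- by rewrite adj_sym.
- by rewrite adj_irrefl in cd.
Qed.

(** A copy of a cube is specified below by its vertices; taking all the edges
    between them turns it into a subgraph. *)
Section InducedSubgraph.
Variables (G : sgraph) (A : {set G}).

Definition induced_val : {set G} * {set {set G}} :=
  (A, [set e in edges G | e \subset A]).

Lemma induced_valP : is_subgraph induced_val.
Proof.
apply/andP; split; first by apply/fintype.subsetP => e; rewrite inE => /andP[].
by apply/forall_inP => e; rewrite inE => /andP[].
Qed.

Definition induced_subgraph : subgraph G := Subgraph induced_valP.

Lemma induced_subgraph_adj (x y : graph_of_subgraph induced_subgraph) :
  adj x y = adj (val x) (val y).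
Proof.
rewrite /= /sub_adj /sub_edges inE mem_edges finset.subUset !finset.sub1set.
by rewrite (valP x) (valP y) !andbT.
Qed.

End InducedSubgraph.

Lemma induced_subgraph_codom (K G : sgraph) (f : K -> G) :
    injective f -> {mono f : x y / adj x y} ->
  isomorphic (graph_of_subgraph (induced_subgraph [set f x | x in K])) K.
Proof.
move=> f_inj f_mono; apply: isomorphic_sym.
pose A := [set f x | x in K].
have fA x : f x \in A by rewrite imset_f.
pose g x : graph_of_subgraph (induced_subgraph A) := exist _ (f x) (fA x).
exists g => [|x y]; last by rewrite induced_subgraph_adj /= f_mono.
apply: inj_card_bij => [x y /(congr1 val)/f_inj //|].
by rewrite /= card_sig (card_imset _ f_inj).
Qed.

(** Families of embeddings with disjoint images are easier to build than sets of
    subgraphs.  The vertex of [K] is what makes distinct indices give distinct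
    subgraphs: without it all the images would be empty. *)
Lemma max_disjoint_copies_ge (K G : sgraph) (I : finType) (f : I -> K -> G) :
    (0 < #|K|) ->
    (forall i, injective (f i)) -> (forall i, {mono f i : x y / adj x y}) ->
    (forall i j x y, f i x = f j y -> i = j) ->
  #|I| <= max_disjoint_copies K G.
Proof.
move=> /card_gt0P[x0 _] f_inj f_mono f_disj.
pose H i := induced_subgraph [set f i x | x in K].
have H_inj : injective H.
  move=> i j /(congr1 (@sub_verts G)) /setP /(_ (f i x0)).
  by rewrite imset_f // => /esym /imsetP[y _ /f_disj].
rewrite -(card_imset _ H_inj).
apply: (@leq_bigmax_cond _ _ (fun F : {set subgraph G} => #|F|)).
apply/asboolP; split => [_ /imsetP[i _ ->]|_ _ /imsetP[i _ ->] /imsetP[j _ ->]].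
  exact: induced_subgraph_codom.
apply: contraR => /pred0Pn[_ /andP[/imsetP[x _ ->] /imsetP[y _ /f_disj ->]]].
exact: eqxx.
Qed.

(** * Hamming distance and Fibonacci strings *)

(** Unlike the cardinal in [cube_adj], this computes on strings with a given
    prefix. *)
Definition hamming (s t : bitseq) : nat := count (fun p => p.1 != p.2) (zip s t).

Lemma hamming_tuple (n : nat) (x y : n.-tuple bool) :
  #|[set i | tnth x i != tnth y i]| = hamming x y.
Proof.
rewrite /hamming; have -> : zip x y = [seq (tnth x i, tnth y i) | i <- enum 'I_n].
  by rewrite -zip_map !map_tnth_enum.
rewrite count_map cardE size_filter enumT.
by apply: eq_count => i; rewrite /= inE.
Qed.

Lemma cube_adjE (n : nat) (x y : n.-tuple bool) : cube_adj x y = (hamming x y == 1).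
Proof. by rewrite /cube_adj hamming_tuple. Qed.

Lemma hamming_eq0 (s t : bitseq) : size s = size t -> hamming s t = 0 -> s = t.
Proof.
elim: s t => [|b s IHs] [|c t] //= [sz]; rewrite /hamming /= -/(hamming s t).
by have [->|//] := eqVneq b c; rewrite add0n => /(IHs _ sz) ->.
Qed.

Lemma hamming_refl (s : bitseq) : hamming s s = 0.
Proof. by elim: s => //= b s IHs; rewrite /hamming /= eqxx. Qed.

Local Notation fib := (sorted (fun a b : bool => ~~ (a && b))).

Lemma fib_cons0 (s : bitseq) : fib (false :: s) = fib s.
Proof. by case: s. Qed.

Lemma fib_consb0 (b : bool) (s : bitseq) : fib (b :: false :: s) = fib s.
Proof. by rewrite -(fib_cons0 s) /= andbF. Qed.

Lemma card_fib_cubeE (n : nat) : #|fib_cube n| = #|[set x : n.-tuple bool | fib x]|.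
Proof. exact: card_sig. Qed.

(** The strings starting with 0, and those starting with 1, hence with 10. *)
Lemma card_fib_cube_rec (n : nat) :
  #|fib_cube n.+2| = #|fib_cube n.+1| + #|fib_cube n|.
Proof.
rewrite !card_fib_cubeE.
pose f0 (x : n.+1.-tuple bool) := [tuple of false :: x].
pose f1 (x : n.-tuple bool) := [tuple of true :: false :: x].
have f0_inj : injective f0 by move=> x y [/val_inj].
have f1_inj : injective f1 by move=> x y [/val_inj].
rewrite -(card_imset _ f0_inj) -(card_imset _ f1_inj) -cardsUI.
rewrite [X in _ = _ + X](_ : _ = 0) ?addn0; last first.
  by apply: eq_card0 => x; rewrite !inE; apply/negP => /andP[/imsetP[y _ ->] /imsetP[]].
apply: eq_card => x; rewrite !inE; apply/idP/orP => [|[]/imsetP[y fy ->]]; last 2 first.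
- by rewrite inE in fy; rewrite fib_cons0.
- by rewrite inE in fy; rewrite fib_consb0.
case/tupleP: x => b x.
case: b => [|fx]; last first.
  by left; apply/imsetP; exists x => //; rewrite inE -fib_cons0.
case/tupleP: x => -[|] x //; rewrite fib_consb0 => fx.
by right; apply/imsetP; exists x; [rewrite inE | apply: val_inj].
Qed.

Lemma card_fib_cube_small (n : nat) : n <= 2 -> #|fib_cube n| <= 3.
Proof.
have c0 : #|fib_cube 0| <= 1.
  by rewrite card_fib_cubeE (leq_trans (max_card _)) // card_tuple card_bool.
have c1 : #|fib_cube 1| <= 2.
  by rewrite card_fib_cubeE (leq_trans (max_card _)) // card_tuple card_bool.
case: n => [|[|[|]]] // _; [exact: leq_trans c0 _|exact: leq_trans c1 _|].
by rewrite card_fib_cube_rec (leq_add c1 c0).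
Qed.

(** * Packing cubes in the Fibonacci cube *)

(** Asking for isometries rather than graph embeddings makes injectivity
    automatic and lets the distance be computed prefix by prefix. *)
Definition packs (k n : nat) (I : finType)
    (f : I -> k.-tuple bool -> n.-tuple bool) : Prop :=
  [/\ forall i x, fib (f i x),
      forall i x y, hamming (f i x) (f i y) = hamming x y
    & forall i j x y, f i x = f j y -> i = j].

Lemma packs_q (k n : nat) (I : finType)
    (f : I -> k.-tuple bool -> n.-tuple bool) :
  packs f -> #|I| <= q k n.
Proof.
move=> [f_fib f_ham f_disj].
have fP i x : f i x \in [set x : n.-tuple bool | no_consecutive_ones x].
  by rewrite inE; apply: f_fib.
pose g i (x : cube k) : fib_cube n := exist _ (f i x) (fP i x).
apply: (@max_disjoint_copies_ge _ _ _ g).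
- by rewrite card_cube expn_gt0.
- move=> i x y /(congr1 val) /= fxy; apply/val_inj/hamming_eq0.
    by rewrite !size_tuple.
  by rewrite -(f_ham i) fxy hamming_refl.
- by move=> i x y; rewrite /= /induced_adj /= !cube_adjE f_ham.
- by move=> i j x y /(congr1 val) /= /f_disj.
Qed.

(** A k-cube [f i] in dimension n+1 gives the (k+1)-cube formed by its two
    translates with prefixes 00 and 10, the new coordinate of the cube being the
    first letter; a (k+1)-cube [g j] in dimension n is translated by 010.  The
    second letter separates the two kinds. *)
Lemma packs_step (k n : nat) (I J : finType)
    (f : I -> k.-tuple bool -> n.+1.-tuple bool)
    (g : J -> k.+1.-tuple bool -> n.-tuple bool) :
  packs f -> packs g ->
  exists h : I + J -> k.+1.-tuple bool -> n.+3.-tuple bool, packs h.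
Proof.
move=> [f_fib f_ham f_disj] [g_fib g_ham g_disj].
pose h (u : I + J) (x : k.+1.-tuple bool) : n.+3.-tuple bool :=
  match u with
  | inl i => [tuple of [:: thead x, false & f i [tuple of behead x]]]
  | inr j => [tuple of [:: false, true, false & g j x]]
  end.
exists h; split.
- by case=> [i|j] x; rewrite /h ?fib_consb0 // fib_cons0 fib_consb0.
- case=> [i|j] x y; last by rewrite /h /hamming /= -/(hamming _ _) g_ham.
  case/tupleP: x => b x; case/tupleP: y => c y.
  rewrite /h !theadE /hamming /= -!/(hamming _ _) f_ham /=.
  by rewrite /hamming /= !add0n.
- case=> [i|j] [i'|j'] x y /(congr1 val) //= [] // .
  + by move=> _ /val_inj /f_disj ->.
  + by move=> /val_inj /g_disj ->.
Qed.

(** For k = 0 the single vertices cover everything.  For n <= 2 the empty packing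
    leaves at most 3 vertices.  Otherwise the bound propagates through
    [packs_step] because
      2 * 3(n+2)^k + 3(n+1)^(k+1) <= 3(2 + (n+1)) (n+4)^k <= 3(n+4)^(k+1). *)
Lemma packs_exists (k n : nat) :
  exists (I : finType) (f : I -> k.-tuple bool -> n.-tuple bool),
    packs f /\ #|fib_cube n| <= 2 ^ k * #|I| + 3 * n.+1 ^ k.
Proof.
elim: k n => [|k IHk] n.
  exists (fib_cube n), (fun v _ => val v); split; last first.
    by rewrite expn0 mul1n leq_addr.
  split=> [v _|v x y|v w x y /val_inj //].
    by have := valP v; rewrite inE.
  by rewrite hamming_refl (tuple0 x) (tuple0 y).
elim/ltn_ind: n => n IHn.
have [n2|] := leqP n 2.
  exists void, (fun (v : void) _ => match v with end); split; first by split; case.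
  rewrite (leq_trans (card_fib_cube_small n2)) // (leq_trans _ (leq_addl _ _)) //.
  by rewrite leq_pmulr // expn_gt0.
case: n IHn => [|[|[|n]]] // IHn _.
have [I [f [pf cf]]] := IHk n.+1.
have [J [g [pg cg]]] := IHn n (leq_addl 2 n.+1).
have [h ph] := packs_step pf pg.
exists (I + J)%type, h; split=> //.
rewrite card_sum !card_fib_cube_rec.
rewrite !expnS in cg *.
(* Both powers are reduced to (n+4)^k, after which only products remain. *)
have le m : m <= n.+3 -> m.+1 ^ k <= n.+4 ^ k.
  by move=> mn; case: (posnP k) => [->|k0]; rewrite ?expn0 // leq_exp2r.
have le1 := le n.+1 (leq_addl 2 n.+1).
have le2 := le n (leq_addl 3 n).
nia.
Qed.

(** * Growth of the Fibonacci cube *)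

Lemma card_fib_cube_mono (n : nat) : #|fib_cube n| <= #|fib_cube n.+1|.
Proof.
case: n => [|n]; last by rewrite card_fib_cube_rec leq_addr.
rewrite !card_fib_cubeE.
have f_inj : injective (fun x : 0.-tuple bool => [tuple of false :: x]).
  by move=> x y _; rewrite (tuple0 x) (tuple0 y).
rewrite -(card_imset _ f_inj) subset_leq_card //.
apply/fintype.subsetP => _ /imsetP[x fx ->].
by rewrite !inE in fx *; rewrite fib_cons0.
Qed.

Lemma exp2_half_le_card (n : nat) : 2 ^ n./2 <= #|fib_cube n|.
Proof.
elim/ltn_ind: n => -[|[|n]] IHn.
- by rewrite card_fib_cubeE; apply/card_gt0P; exists [tuple]; rewrite inE.
- exact: leq_trans (IHn 0 isT) (card_fib_cube_mono 0).
- rewrite card_fib_cube_rec /= expnS mul2n -addnn leq_add ?IHn //.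
  exact: leq_trans (IHn n _) (card_fib_cube_mono n).
Qed.

(** With t the quotient of n by 2j, one has n+1 <= 2j(t+1) and t+1 <= 2^t, so
    (n+1)^j <= (2j)^j * 2^(tj), where tj <= n/2. *)
Lemma expn_le_card_fib_cube (j n : nat) :
  0 < j -> n.+1 ^ j <= (2 * j) ^ j * #|fib_cube n|.
Proof.
move=> j0; set t := n %/ (2 * j).
have nt : n.+1 <= 2 * j * t.+1 by rewrite mulnC ltn_ceil // muln_gt0.
apply: (@leq_trans ((2 * j * t.+1) ^ j)); first by rewrite leq_exp2r.
rewrite expnMn leq_mul2l; apply/orP; right.
apply: (@leq_trans ((2 ^ t) ^ j)); first by rewrite leq_exp2r // ltn_expl.
rewrite -expnM (leq_trans _ (exp2_half_le_card n)) // leq_exp2l //.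
have : t * (2 * j) <= n by rewrite leq_trunc_div.
by rewrite -divn2 leq_divRL //; lia.
Qed.

(** * The density of an optimal packing *)

Lemma q_upper (k n : nat) : q k n * 2 ^ k <= #|fib_cube n|.
Proof. by rewrite -(card_cube k); apply: max_disjoint_copies_le. Qed.

Lemma q_lower (k n : nat) : #|fib_cube n| <= 2 ^ k * q k n + 3 * n.+1 ^ k.
Proof.
have [I [f [pf cf]]] := packs_exists k n.
by rewrite (leq_trans cf) // leq_add2r leq_mul2l (packs_q pf) orbT.
Qed.

(** The growth bound is used with exponent k+1, one more than in [q_lower]: the
    spare factor n+1 makes the uncovered proportion tend to 0. *)
Lemma q_deficit (k n : nat) :
  n.+1 * #|fib_cube n| <=
  n.+1 * (2 ^ k * q k n) + 3 * (2 * k.+1) ^ k.+1 * #|fib_cube n|.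
Proof.
rewrite (leq_trans (leq_mul (leqnn n.+1) (q_lower k n))) // mulnDr leq_add2l.
by rewrite mulnCA -expnS -mulnA leq_mul2l expn_le_card_fib_cube.
Qed.

Local Open Scope classical_set_scope.
Local Open Scope ring_scope.

Lemma le_div_deficit (R : realFieldType) (N V K Q C : R) :
    0 < N -> 0 < V -> 0 < K -> N * V <= N * (K * Q) + C * V ->
  1 / K - C / K / N <= Q / V.
Proof.
move=> N0 V0 K0 deficit; rewrite ler_pdivlMr //.
rewrite (_ : _ * V = (N * V - C * V) / (N * K)); last first.
  by field; rewrite !gt_eqF.
by rewrite ler_pdivrMr ?mulr_gt0 //; lra.
Qed.

Theorem theorem1p2 (R : realType) (k : nat) (hk : (1 <= k)%N) :
  (fun n : nat => (q k n)%:R / #|fib_cube n|%:R : R) @ \oo --> (1 / 2 ^+ k : R).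
Proof.
pose c : R := (3 * (2 * k.+1) ^ k.+1)%N%:R / 2 ^+ k.
have k2 : 0 < 2 ^+ k :> R by rewrite exprn_gt0.
apply: (@squeeze_cvgr _ _ _ _ (fun n => 1 / 2 ^+ k - c * n.+1%:R^-1)
                              (fun=> 1 / 2 ^+ k)).
- near=> n.
  have v0 : 0 < #|fib_cube n|%:R :> R.
    by rewrite ltr0n (leq_trans _ (exp2_half_le_card n)) // expn_gt0.
  have n0 : 0 < n.+1%:R :> R by rewrite ltr0n.
  apply/andP; split.
  + apply: le_div_deficit => //.
    by rewrite -natrX -!natrM -natrD ler_nat q_deficit.
  + rewrite ler_pdivlMr // mulrAC ler_pdivrMr // mul1r.
    by rewrite -natrX -natrM ler_nat q_upper.
- rewrite -[X in _ --> X]subr0; apply: cvgB; first exact: cvg_cst.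
  by rewrite -[X in _ --> X](mulr0 c); apply: cvgMr; exact: cvg_harmonic.
- exact: cvg_cst.
Unshelve. all: by end_near. Qed.
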